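(* Let $\mathcal{S}=\{(1,1),(1,-1),(1,0)\}$ with $w(s)=1$ and $l(s)=1$ for every $s\in\mathcal{S}$. For all integers $0\le m\le n$, the number of $(\mathcal{S},1)$-lattice paths with length $n+1$ and non-positive length $m$ is the $n$-th Motzkin number.
   Context: An $(\mathcal{S},1)$-lattice path is a finite sequence $L=s_1\cdots s_r$ of steps in $\mathcal{S}$ starting at $(0,0)=(x_0,y_0)$, with successive points $(x_j,y_j)=(x_{j-1},y_{j-1})+s_j$, and ending on the line $y=1$. Its length is $l(L)=\sum_{j} l(s_j)$ (here, the number of steps). The height of step $s_j$ is $h(s_j)=y_j$, the ordinate of its end point. The non-positive length of $L$ is $\bar l(L)=\sum_{j:\,h(s_j)\le 0} l(s_j)$ (here, the number of steps whose end point has ordinate $\le 0$). The $n$-th Motzkin number $m_n$ is the number of paths with $n$ steps in $\{(1,1),(1,-1),(1,0)\}$ from $(0,0)$ to the line $y=0$ that never go below $y=0$; equivalently $M(z)=\sum_{n\ge0}m_nz^n$ satisfies $M(z)=1+zM(z)+z^2M(z)^2$. *)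

(* Defs.v *)
From mathcomp Require Import all_boot all_order all_algebra.

Set Implicit Arguments.
Unset Strict Implicit.
Unset Printing Implicit Defensive.

Import Order.TTheory GRing.Theory Num.Theory.
Local Open Scope ring_scope.

Definition step : Type := (int * int)%type.

(* The ordinate y_j; [take j L] consists of the steps s_1, ..., s_j. *)
Definition ordinate (L : seq step) (j : nat) : int :=
  \sum_(s <- take j L) s.2.

(* The abscissa of the final point is unconstrained. *)
Definition lattice_path (S : seq step) (k : int) (L : seq step) : bool :=
  all (mem S) L && (ordinate L (size L) == k).

Definition unit_length : step -> nat := fun=> 1%N.

Definition path_length (l : step -> nat) (L : seq step) : nat :=
  (\sum_(s <- L) l s)%N.

(* Indices are shifted: [nth _ L j] is s_(j+1), whose height is y_(j+1). *)
Definition nonpos_length (l : step -> nat) (L : seq step) : nat :=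
  (\sum_(j < size L | (ordinate L j.+1 <= 0)%R) l (nth (0%R, 0%R) L j))%N.

Definition motzkin_steps : seq step := [:: (1, 1); (1, -1); (1, 0)].

Definition motzkin_path (L : seq step) : bool :=
  lattice_path motzkin_steps 0 L &&
  [forall j : 'I_(size L).+1, 0 <= ordinate L j].

Definition motzkin (n : nat) : nat :=
  #|[set L : n.-tuple (seq_sub motzkin_steps) | motzkin_path (map val L)]|.

(* Main.v *)
Require Import Defs.
From mathcomp Require Import all_boot all_order all_algebra.
From mathcomp Require Import boolp classical_sets functions cardinality.
From mathcomp Require Import zify.
Set Implicit Arguments.
Unset Strict Implicit.
Unset Printing Implicit Defensive.

Import Order.TTheory GRing.Theory Num.Theory.
Local Open Scope classical_set_scope.

(** This is a cycle-lemma argument. Let [L] be a path with [N = n.+1] steps that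
ends at height 1, with heights [y_1, ..., y_N]. Start [L] afresh after its [i]-th
step, moving the first [i] steps to the end. Step [j] then ends at height
[y_j - y_i] if [j > i], and at height [1 + y_j - y_i] if [j <= i], because it now
comes after a full climb of 1. So step [j] counts in the non-positive length of
the rotated path exactly when [y_j < y_i], or [y_j = y_i] and [j > i]. This is a
strict total order on [{1, ..., N}], so the non-positive length is the rank of
[i] in it ([nonpos_rot]), and the [N] rotations of [L] have the non-positive
lengths [0, ..., n], each exactly once ([nonpos_rot_inj], [nonpos_rot_surj]).

Every rotation class of paths therefore contains exactly one path of each
non-positive length between 0 and [n], so the number of paths is the same for all
of these lengths ([card_paths_le], used in both directions). For non-positive
length 0 all heights are at least 1: the first step is an up step, and what
follows is a Motzkin path with [n] steps lifted by 1 ([paths_to_one0E]). *)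

(** * Ranks in a finite strict total order *)

(** The predecessors of the smaller of two elements, and that element itself, are
predecessors of the larger one, which therefore has more of them. *)
Lemma strict_rank_inj (T : finType) (r : rel T) :
    irreflexive r -> transitive r -> (forall x y, x != y -> r x y || r y x) ->
  injective (fun x => #|[pred y | r y x]|).
Proof.
move=> r_irr r_tr r_tot x y eq_rank; apply/eqP/negPn/negP => ne_xy.
wlog r_xy : x y eq_rank ne_xy / r x y.
  move=> wlg; have /orP[/wlg|/wlg] := r_tot x y ne_xy; first exact.
  by apply; rewrite // eq_sym.
have /proper_card : [pred z | r z x] \proper [pred z | r z y].
  apply/properP; split; last by exists x; rewrite !inE // r_irr.
  by apply/fintype.subsetP => z; rewrite !inE => /r_tr; apply.
by rewrite eq_rank ltnn.
Qed.

Lemma strict_rank_lt (T : finType) (r : rel T) (x : T) :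
  irreflexive r -> (#|[pred y | r y x]| < #|T|)%N.
Proof.
move=> r_irr; apply: proper_card; apply/properP; split; first exact/fintype.subsetP.
by exists x; rewrite // inE r_irr.
Qed.

(** * Heights of a rotated path *)

Lemma ordinate0 (L : seq step) : ordinate L 0 = 0%R.
Proof. by rewrite /ordinate take0 big_nil. Qed.

Lemma ordinate_cons (s : step) (L : seq step) (j : nat) :
  ordinate (s :: L) j.+1 = (s.2 + ordinate L j)%R.
Proof. by rewrite /ordinate /= big_cons. Qed.

Lemma ordinateE (L : seq step) : ordinate L (size L) = (\sum_(s <- L) s.2)%R.
Proof. by rewrite /ordinate take_size. Qed.

Lemma ordinate_drop (L : seq step) (i k : nat) :
  ordinate (drop i L) k = (ordinate L (i + k) - ordinate L i)%R.
Proof. by rewrite /ordinate takeD big_cat /= addrAC subrr add0r. Qed.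

Lemma ordinate_rot_before (L : seq step) (i k : nat) :
  (i + k <= size L)%N ->
  ordinate (rot i L) k = (ordinate L (i + k) - ordinate L i)%R.
Proof.
move=> le_ik; rewrite -ordinate_drop /ordinate /rot takel_cat //.
by rewrite size_drop; lia.
Qed.

(** The last [i] steps of the rotated path run after the total climb of [L],
hence the extra term [ordinate L (size L)]. *)
Lemma ordinate_rot_after (L : seq step) (i k : nat) :
  (k <= i)%N -> (i <= size L)%N ->
  ordinate (rot i L) (size L - i + k)
    = (ordinate L (size L) - ordinate L i + ordinate L k)%R.
Proof.
move=> le_ki le_iL; rewrite -{2}(subnKC le_iL) -ordinate_drop /ordinate /rot.
rewrite -size_drop takeD take_size_cat // drop_size_cat // big_cat /=.
by rewrite take_takel // take_size.
Qed.

(** * The non-positive length of a rotation is a rank *)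

(** The index [j] stands for the step whose end point has height
[ordinate L j.+1]. Among equal heights the later step comes first, since after
rotation an earlier step of the same height is lifted to height 1. *)
Definition below (L : seq step) : rel 'I_(size L) := fun j i =>
  (ordinate L j.+1 < ordinate L i.+1)%R
  || (ordinate L j.+1 == ordinate L i.+1) && (i < j)%N.

Lemma below_irr (L : seq step) : irreflexive (@below L).
Proof. by move=> i; rewrite /below ltxx ltnn andbF. Qed.

Lemma below_trans (L : seq step) : transitive (@below L).
Proof. by move=> j i k; rewrite /below; lia. Qed.

Lemma below_total (L : seq step) (i j : 'I_(size L)) :
  i != j -> below i j || below j i.
Proof. by rewrite -val_eqE /= /below; lia. Qed.

Lemma nonpos_rot (L : seq step) (i : 'I_(size L)) :
  ordinate L (size L) = 1%R ->
  nonpos_length unit_length (rot i.+1 L) = #|[pred j | below j i]|.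
Proof.
move=> L1; have lt_iL := ltn_ord i.
pose P k := (ordinate (rot i.+1 L) k.+1 <= 0)%R.
pose Q j := (ordinate L j.+1 < ordinate L i.+1)%R
  || (ordinate L j.+1 == ordinate L i.+1) && (i < j)%N.
transitivity (\sum_(0 <= k < size L | P k) 1)%N.
  by rewrite /nonpos_length -(big_mkord P (fun=> 1%N)) size_rot.
transitivity (\sum_(0 <= j < size L | Q j) 1)%N; last first.
  by rewrite big_mkord -sum1_card.
(* The rotation exchanges a block of [size L - i.+1] steps with a block of
   [i.+1] steps; both sums are cut accordingly. *)
rewrite (big_cat_nat _ (n := size L - i.+1)) ?leq_subr //=.
rewrite [RHS](big_cat_nat _ (n := i.+1)) //= [RHS]addnC; congr (_ + _)%N.
  (* Steps after the chosen starting point: ties count. *)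
  rewrite -{2}[i.+1]add0n big_addn big_nat_cond [RHS]big_nat_cond.
  apply: eq_bigl => k; case: (ltnP k) => //= lt_k.
  rewrite /P /Q ordinate_rot_before ?addnS; last by lia.
  by rewrite addSn addnC subr_le0 le_eqVlt orbC; lia.
(* Steps moved to the end, lifted by 1: only strictly lower ones count. *)
rewrite -{1}[(size L - i.+1)%N]add0n big_addn subKn //.
rewrite big_nat_cond [RHS]big_nat_cond.
apply: eq_bigl => k; case: (ltnP k) => //= lt_k.
by rewrite /P /Q -addSn addnC ordinate_rot_after // L1; lia.
Qed.

(** The rotation by 0 is also the one by [size L], so the shifts may be taken
in [1, ..., size L], the range in which [nonpos_rot] applies. *)
Lemma rotE_succ (T : Type) (L : seq T) (k : nat) :
  (0 < size L)%N -> exists i : 'I_(size L), rot k L = rot i.+1 L.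
Proof.
move=> L_gt0; rewrite rot_minn; case: (posnP (minn k (size L))) => [->|k_gt0].
  have ltL : ((size L).-1 < size L)%N by rewrite ltn_predL.
  by exists (Ordinal ltL); rewrite /= prednK // rot_size rot0.
have ltL : ((minn k (size L)).-1 < size L)%N.
  by rewrite prednK // geq_minr.
by exists (Ordinal ltL); rewrite /= prednK.
Qed.

Lemma ordinate_total_gt0 (L : seq step) :
  ordinate L (size L) = 1%R -> (0 < size L)%N.
Proof. by case: L => //; rewrite ordinate0. Qed.

Lemma ordinate_rot_size (L : seq step) (k : nat) :
  ordinate (rot k L) (size (rot k L)) = ordinate L (size L).
Proof. by rewrite !ordinateE; apply: perm_big; rewrite perm_rot. Qed.

(** The conclusion concerns the rotated paths and not the shifts, so that the
shifts may be arbitrary. *)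
Lemma nonpos_rot_inj (L : seq step) (a b : nat) :
    ordinate L (size L) = 1%R ->
    nonpos_length unit_length (rot a L) = nonpos_length unit_length (rot b L) ->
  rot a L = rot b L.
Proof.
move=> L1; have L_gt0 := ordinate_total_gt0 L1.
have [[i ->] [j ->]] := (rotE_succ a L_gt0, rotE_succ b L_gt0).
rewrite !nonpos_rot //.
by move/(strict_rank_inj (@below_irr L) (@below_trans L) (@below_total L)) => ->.
Qed.

(** The ranks are [size L] distinct numbers below [size L], so each number
below [size L] is one of them. *)
Lemma nonpos_rot_surj (L : seq step) (m : nat) :
    ordinate L (size L) = 1%R -> (m < size L)%N ->
  exists k, nonpos_length unit_length (rot k L) = m.
Proof.
move=> L1 lt_mL.
have rank_lt (i : 'I_(size L)) : (#|[pred j | below j i]| < size L)%N.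
  have := strict_rank_lt i (@below_irr L); rewrite card_ord; apply.
pose rank i := Ordinal (rank_lt i).
have rank_inj : injective rank.
  move=> i j /(congr1 val) /=.
  exact: (strict_rank_inj (@below_irr L) (@below_trans L) (@below_total L)).
have [rank' _ rankK] := injF_bij rank_inj.
exists (rank' (Ordinal lt_mL)).+1; rewrite nonpos_rot //.
by have /(congr1 val) := rankK (Ordinal lt_mL).
Qed.

(** * Equidistribution of the non-positive length *)

Definition paths_to_one (S : seq step) (N m : nat) : set (seq step) :=
  [set L | [/\ lattice_path S 1%R L, path_length unit_length L = N
             & nonpos_length unit_length L = m]].

Lemma path_length_unit (L : seq step) : path_length unit_length L = size L.
Proof. by rewrite /path_length sum1_size. Qed.

(** Rotating each path until its non-positive length is [m'] is injective: two
paths with the same image are rotations of each other and have the same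
non-positive length [m], so they are equal by [nonpos_rot_inj]. *)
Lemma card_paths_le (S : seq step) (N m m' : nat) :
  (m' < N)%N -> (paths_to_one S N m #<= paths_to_one S N m')%card.
Proof.
move=> lt_m'N.
pose good L k := nonpos_length unit_length (rot k L) == m'.
have good_ex L : L \in paths_to_one S N m -> exists k, good L k.
  rewrite inE /paths_to_one /= path_length_unit.
  move=> [/andP[_ /eqP L1] sizeL _].
  have [|k /eqP npk] := nonpos_rot_surj (m := m') L1; first by rewrite sizeL.
  by exists k.
pose f L := if pselect (exists k, good L k) is left e then rot (xchoose e) L else L.
have fP L : L \in paths_to_one S N m -> 
    exists2 k, f L = rot k L & nonpos_length unit_length (f L) = m'.
  move=> /good_ex ex_k; rewrite /f; case: pselect => // e.
  by exists (xchoose e); last exact/eqP/(xchooseP e).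
have f_inj : {in paths_to_one S N m &, injective f}.
  move=> L1 L2 PL1 PL2 eq_f.
  have [[k1 f1 _] [k2 f2 _]] := (fP _ PL1, fP _ PL2).
  move: PL1 PL2; rewrite !inE => -[/andP[_ /eqP tot1] _ np1] [_ _ np2].
  have L2E : L2 = rotr k2 (rot k1 L1) by rewrite -f1 eq_f f2 rotK.
  move: L2E; rewrite /rotr rot_rot_add => L2E.
  by rewrite L2E -[LHS]rot0; apply: nonpos_rot_inj; rewrite // rot0 -L2E np1 np2.
rewrite -(card_le_eql (inj_card_eq f_inj)); apply: subset_card_le.
move=> _ [L PL <-]; have [k fL npf] := fP L (mem_set PL).
case: PL => /andP[allL totL] sizeL _; split=> //.
- rewrite fL /lattice_path ordinate_rot_size totL andbT.
  by rewrite (eq_all_r (mem_rot k L)).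
- by rewrite -sizeL fL !path_length_unit size_rot.
Qed.

(** * Paths that stay positive *)

Lemma nonpos_eq0P (L : seq step) :
  reflect (forall j, (j < size L)%N -> (0 < ordinate L j.+1)%R)
          (nonpos_length unit_length L == 0%N).
Proof.
rewrite /nonpos_length sum_nat_eq0.
apply: (iffP forall_inP) => [pos j lt_jL | pos j].
  by rewrite ltNge; apply/negP => /(pos (Ordinal lt_jL)).
by rewrite leNgt pos.
Qed.

(** A path with all heights positive must begin with an up step, the only step
that ends above height 0; the heights of the rest, measured from height 1, are
then non-negative and end at 0. *)
Lemma paths_to_one0E (n : nat) (L : seq step) :
  paths_to_one motzkin_steps n.+1 0 L <->
  exists L', [/\ L = (1%R, 1%R) :: L', motzkin_path L' & size L' = n].
Proof.
split.
  case: L => [|s L'] [/andP[steps]]; rewrite path_length_unit //= => tot [sizeL'].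
  move=> /eqP/nonpos_eq0P pos.
  have sE : s = (1%R, 1%R).
    have := pos 0%N isT; rewrite ordinate_cons ordinate0 addr0.
    by move: steps => /= /andP[]; rewrite !inE => /or3P[] /eqP ->.
  exists L'; rewrite sE in steps tot pos *; split=> //.
  move: steps tot => /= steps; rewrite ordinate_cons /= => tot.
  rewrite /motzkin_path /lattice_path steps /=; apply/andP; split; first by lia.
  apply/forallP => j; have := pos j; rewrite ordinate_cons /=.
  by have := ltn_ord j; lia.
move=> [L' [-> /andP[/andP[steps /eqP tot] /forallP nneg] sizeL']].
rewrite /paths_to_one /=; split.
- by rewrite /lattice_path /= steps ordinate_cons tot.
- by rewrite path_length_unit /= sizeL'.
apply/eqP/nonpos_eq0P => j lt_j; rewrite ordinate_cons /=.
by have := nneg (Ordinal lt_j); rewrite /=; lia.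
Qed.

Lemma card_finset_image (T : finType) (U : Type) (A : {set T}) (f : T -> U) :
  injective f -> (f @` [set x | x \in A] #= `I_#|A|)%card.
Proof.
move=> f_inj.
have -> : f @` [set x | x \in A] = range (fun i : 'I_#|A| => f (enum_val i)).
  rewrite eqEsubset; split=> _ [x xA <-].
    by exists (enum_rank_in xA x); rewrite // enum_rankK_in.
  by exists (enum_val x); rewrite //= enum_valP.
have fe_inj : {in [set: 'I_#|A|] &, injective (fun i => f (enum_val i))}.
  by move=> i j _ _ /f_inj/enum_val_inj.
by rewrite (card_eql (inj_card_eq fe_inj)) card_eq_sym card_II.
Qed.

Lemma card_paths_to_one0 (n : nat) :
  (paths_to_one motzkin_steps n.+1 0 #= `I_(motzkin n))%card.
Proof.
pose f (t : n.-tuple (seq_sub motzkin_steps)) : seq step :=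
  (1%R, 1%R) :: map val t.
have f_inj : injective f by move=> t u [/(inj_map val_inj)/val_inj].
suff -> : paths_to_one motzkin_steps n.+1 0 =
    f @` [set t | t \in
      [set t : n.-tuple (seq_sub motzkin_steps) | motzkin_path (map val t)]%SET].
  exact: card_finset_image.
rewrite eqEsubset; split=> [L /paths_to_one0E[L' [-> motz sizeL']] | _ [t + <-]].
  have steps : all (mem motzkin_steps) L' by case/andP: motz => /andP[].
  have [u uE] : exists u : seq (seq_sub motzkin_steps), map val u = L'.
    move: steps; clear; elim: L' => [_|s L' IH /= /andP[sS /IH[u <-]]].
      by exists [::].
    by exists (SeqSub sS :: u).
  have size_u : size u == n by rewrite -sizeL' -uE size_map.
  by exists (Tuple size_u); rewrite /f /= ?inE uE.
rewrite /= inE => motz; apply/paths_to_one0E.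
by exists (map val t); rewrite size_map size_tuple.
Qed.

Theorem corollary3p6 (m n : nat) (le_mn : (m <= n)%N) :
  ([set L : seq step | [/\ lattice_path motzkin_steps 1%R L,
                           path_length unit_length L = n.+1
                         & nonpos_length unit_length L = m]] #= `I_(motzkin n))%card.
Proof.
have W0m : (paths_to_one motzkin_steps n.+1 m #=
            paths_to_one motzkin_steps n.+1 0)%card.
  by apply: Cantor_Bernstein; apply: card_paths_le.
exact: card_eq_trans W0m (card_paths_to_one0 n).
Qed.
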